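(* For an integral domain $D$ the following are equivalent: (i) $D$ is a valuation domain; (ii) $D$ is a $t$-local GCD domain (or, equivalently, a $t$-local Bézout domain); (iii) $D$ is a $t$-local P$v$MD (or, equivalently, a $t$-local Prüfer domain).
   Context: Let $K$ be the quotient field of $D$. For a nonzero fractional ideal $E$ of $D$ put $E^{-1}=\{x\in K: xE\subseteq D\}$, $E^v=(E^{-1})^{-1}$, and $E^t=\bigcup\{F^v : F\subseteq E,\ F \text{ a nonzero finitely generated ideal}\}$; by convention $(0)^v=(0)^t=(0)$. $E$ is a $t$-ideal if $E=E^t$. ''Local'' means having exactly one maximal ideal (not necessarily Noetherian). An integral domain is $t$-local if it is local and its maximal ideal is a $t$-ideal (so a field is $t$-local). $D$ is a GCD domain if $aD\cap bD$ is principal for all $a,b\in D$; a Bézout (respectively Prüfer) domain if every nonzero finitely generated ideal is principal (respectively invertible); a P$v$MD (Prüfer $v$-multiplication domain) if $(FF^{-1})^t=D$ for every nonzero finitely generated fractional ideal $F$ of $D$. Fields are counted as valuation domains. *)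

(* Defs.v *)
From mathcomp Require Import all_boot all_algebra.
From mathcomp Require Import boolp classical_sets.

Set Implicit Arguments.
Unset Strict Implicit.
Unset Printing Implicit Defensive.

Import GRing.Theory.
Local Open Scope classical_set_scope.
Local Open Scope ring_scope.

Notation "x %:F" := (@FracField.tofrac _ x) : ring_scope.

(* Ideals of [D] are sets of elements of [D]; fractional ideals, and the
   operations on them, are sets of elements of the quotient field
   [{fraction D}].  An ideal [I] of [D] is viewed as a fractional ideal through
   its image [frac_of I]. *)

Section Ideals.
Variable D : idomainType.
Implicit Types I J M : set D.

Definition is_ideal I : Prop :=
  [/\ I 0, (forall x y, I x -> I y -> I (x + y))
    & (forall r x, I x -> I (r * x))].

Definition ideal_span n (a : 'I_n -> D) : set D :=
  [set x | exists c : 'I_n -> D, x = \sum_(i < n) c i * a i].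

Definition fg_ideal I : Prop := exists n (a : 'I_n -> D), I = ideal_span a.

Definition principal_set (a : D) : set D := [set r * a | r in [set: D]].

Definition principal_ideal I : Prop := exists a : D, I = principal_set a.

Definition maximal_ideal M : Prop :=
  [/\ is_ideal M, M <> [set: D]
    & forall J, is_ideal J -> M `<=` J -> J = M \/ J = [set: D]].

Definition frac_of I : set {fraction D} := [set x%:F | x in I].

End Ideals.

Section FractionalIdeals.
Variable D : idomainType.
Local Notation K := {fraction D}.
Implicit Types E F : set K.

Definition fractional_ideal E : Prop :=
  [/\ E 0, (forall x y, E x -> E y -> E (x + y)),
      (forall (r : D) x, E x -> E (r%:F * x))
    & exists2 d : D, d != 0 & forall x, E x -> frac_of [set: D] (d%:F * x)].

Definition frac_span n (a : 'I_n -> K) : set K :=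
  [set x | exists c : 'I_n -> D, x = \sum_(i < n) (c i)%:F * a i].

Definition nonzero_fg_fractional_ideal F : Prop :=
  [/\ fractional_ideal F, F <> [set 0]
    & exists n (a : 'I_n -> K), F = frac_span a].

Definition frac_inv E : set K :=
  [set x | [set x * y | y in E] `<=` frac_of [set: D]].

Definition frac_mul E F : set K :=
  [set x | exists n (a b : 'I_n -> K),
     [/\ forall i, E (a i), forall i, F (b i) & x = \sum_(i < n) a i * b i]].

(* The test implements the convention (0)^v = (0)^t = (0): without it the union
   defining (0)^t would be empty, and (0)^v would be K when [D] is a field. *)
Definition v_closure E : set K :=
  if `[< E = [set 0] >] then [set 0] else frac_inv (frac_inv E).

Definition t_closure E : set K :=
  if `[< E = [set 0] >] then [set 0] else
  \bigcup_(F in [set F | nonzero_fg_fractional_ideal F /\ F `<=` E])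
    v_closure F.

Definition t_ideal E : Prop := E = t_closure E.

Definition invertible E : Prop := frac_mul E (frac_inv E) = frac_of [set: D].

End FractionalIdeals.

Section Domains.
Variable D : idomainType.

Definition local_domain : Prop := exists! M : set D, maximal_ideal M.

Definition t_local : Prop :=
  local_domain /\ forall M : set D, maximal_ideal M -> t_ideal (frac_of M).

Definition valuation_domain : Prop :=
  forall x : {fraction D},
    x != 0 -> frac_of [set: D] x \/ frac_of [set: D] x^-1.

Definition GCD_domain : Prop :=
  forall a b : D, principal_ideal (principal_set a `&` principal_set b).

Definition Bezout_domain : Prop :=
  forall I : set D, fg_ideal I -> I <> [set 0] -> principal_ideal I.

Definition Prufer_domain : Prop :=
  forall I : set D, fg_ideal I -> I <> [set 0] -> invertible (frac_of I).

Definition PvMD : Prop :=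
  forall F : set {fraction D}, nonzero_fg_fractional_ideal F ->
    t_closure (frac_mul F (frac_inv F)) = frac_of [set: D].

End Domains.

(* Main.v *)
Require Import Defs.
From mathcomp Require Import all_boot all_algebra.
From mathcomp Require Import boolp classical_sets generic_quotient.

(** Everything rests on one property of a t-local domain D with maximal ideal
    M ([t_local_one]): if E is a set of elements of D whose t-closure contains
    1, then E contains a unit.  Otherwise E lies in M, the set of all nonunits,
    so E^t lies in M^t = M, which does not contain 1.

    In a t-local GCD domain, let aD and bD meet in mD, with m = au = bw.  If x
    is in (u, w)^-1 then xm lies in aD and in bD, hence in mD, so x is in D.
    Thus (u, w)^-1 = D and (u, w)^v = D, so the ideal (u, w) contains a unit.
    In a local domain nonunits are closed under sums, so u or w is a unit, that
    is, one of a, b divides the other ([GCD_valuation]).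

    In a t-local PvMD, the t-closure of F F^-1 is D for every nonzero finitely
    generated ideal F, so F F^-1 contains a unit and F is invertible
    ([PvMD_Prufer]).  A local Pruefer domain is a valuation domain: from
    aD + bD invertible, 1 is a sum of elements ap and bq of D with p and q in
    the inverse ideal; one of these is a unit, because nonunits are closed under
    sums, and then a divides b or b divides a ([Prufer_valuation]).

    Conversely, in a valuation domain divisibility is total.  Hence nonunits are
    closed under sums and form the only maximal ideal, finitely generated ideals
    are principal, and a nonzero finitely generated ideal inside M is some cD,
    which equals its own v-closure, so that M^t = M.  Finally, in a Bezout
    domain every nonzero finitely generated fractional ideal is principal after
    clearing denominators, hence invertible. *)

Set Implicit Arguments.
Unset Strict Implicit.
Unset Printing Implicit Defensive.

Import GRing.Theory.
Local Open Scope classical_set_scope.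
Local Open Scope ring_scope.

(** * Fractions *)

Section Fractions.
Variable D : idomainType.
Local Notation K := {fraction D}.

Lemma fracP (x : K) : exists a b : D, b != 0 /\ x = a%:F / b%:F.
Proof.
elim/quotW: x => x; exists x.1, x.2; split; first exact: denom_ratioP.
apply: (canRL (mulfK _)); first by rewrite tofrac_eq0 denom_ratioP.
have x2n0 := denom_ratioP x.
apply/eqP; rewrite !piE /FracField.mulf /= !numden_Ratio ?oner_neq0 //.
by rewrite mulr1 FracField.equivfE !numden_Ratio ?oner_neq0 // mulr1 mulrC.
Qed.

Lemma tofrac_inj : injective (@FracField.tofrac D).
Proof. by move=> x y /eqP; rewrite tofrac_eq => /eqP. Qed.

Lemma fracT (r : D) : frac_of [set: D] r%:F.
Proof. by exists r. Qed.

Lemma frac_ofE (I : set D) (r : D) : frac_of I r%:F -> I r.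
Proof. by case=> s Is /tofrac_inj <-. Qed.

Lemma frac_of_eq0 (I : set D) : frac_of I = [set 0] -> I = [set 0].
Proof.
move=> I0; apply/seteqP; split=> [x Ix|_ ->].
  have : [set (0 : K)] x%:F by rewrite -I0; exists x.
  by move=> /eqP; rewrite tofrac_eq0 => /eqP.
by apply: frac_ofE; rewrite tofrac0 I0.
Qed.

Lemma principal_setP (a b : D) :
  principal_set a b <-> exists r, b = r * a.
Proof. by split=> [[r _ <-]|[r ->]]; exists r. Qed.

Lemma valuation_domainP :
  valuation_domain D <->
  forall a b : D, principal_set a b \/ principal_set b a.
Proof.
split=> [valD a b|dvdD x x0].
  have [->|a0] := eqVneq a 0; first by right; exists 0; rewrite ?mul0r.
  have [->|b0] := eqVneq b 0; first by left; exists 0; rewrite ?mul0r.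
  have aF : a%:F != 0 :> K by rewrite tofrac_eq0.
  have bF : b%:F != 0 :> K by rewrite tofrac_eq0.
  have [|[r _]|[r _]] := valD (a%:F / b%:F).
    by rewrite mulf_neq0 ?invr_eq0.
    move=> /(canLR (mulfVK bF)); rewrite -tofracM => /tofrac_inj <-.
    by right; exists r.
  rewrite invf_div => /(canLR (mulfVK aF)); rewrite -tofracM => /tofrac_inj <-.
  by left; exists r.
have [a [b [b0 xE]]] := fracP x.
have bF : b%:F != 0 :> K by rewrite tofrac_eq0.
have aF : a%:F != 0 :> K by apply: contraNneq x0 => a0; rewrite xE a0 mul0r.
have [[r _ rab]|[r _ rba]] := dvdD a b; rewrite xE ?invf_div.
  by right; exists r; rewrite // -rab tofracM mulfK.
by left; exists r; rewrite // -rba tofracM mulfK.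
Qed.

End Fractions.

(** * Finitely generated, inverse and product ideals *)

Section Ideals.
Variable D : idomainType.
Local Notation K := {fraction D}.
Implicit Types (I J : set D) (E F : set K).

Lemma ideal_span_ideal n (a : 'I_n -> D) : is_ideal (ideal_span a).
Proof.
split.
- by exists (fun=> 0); rewrite big1 // => i _; rewrite mul0r.
- move=> _ _ [c ->] [d ->]; exists (fun i => c i + d i).
  by rewrite -big_split; apply: eq_bigr => i _; rewrite mulrDl.
- move=> r _ [c ->]; exists (fun i => r * c i).
  by rewrite mulr_sumr; apply: eq_bigr => i _; rewrite mulrA.
Qed.

Lemma ideal_span_gen n (a : 'I_n -> D) i : ideal_span a (a i).
Proof.
exists (fun j => (j == i)%:R); rewrite (bigD1 i) //= eqxx mul1r big1 ?addr0 //.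
by move=> j /negPf ->; rewrite mul0r.
Qed.

Lemma ideal_sum J n (f : 'I_n -> D) :
  is_ideal J -> (forall i, J (f i)) -> J (\sum_(i < n) f i).
Proof. by case=> J0 JD _ Jf; elim/big_ind: _. Qed.

Lemma ideal_span_sub J n (a : 'I_n -> D) :
  is_ideal J -> (forall i, J (a i)) -> ideal_span a `<=` J.
Proof.
by move=> idJ Ja _ [c ->]; apply: ideal_sum => // i; case: idJ => _ _; apply.
Qed.

Lemma principal_set_ideal (a : D) : is_ideal (principal_set a).
Proof.
split; first by exists 0; rewrite ?mul0r.
- by move=> _ _ [r _ <-] [s _ <-]; exists (r + s); rewrite ?mulrDl.
- by move=> s _ [r _ <-]; exists (s * r); rewrite ?mulrA.
Qed.

Lemma principal_span (a : D) : principal_set a = ideal_span (fun _ : 'I_1 => a).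
Proof.
apply/seteqP; split.
  by move=> _ [r _ <-]; exists (fun=> r); rewrite big_ord1.
apply: ideal_span_sub; first exact: principal_set_ideal.
by move=> _; exists 1; rewrite ?mul1r.
Qed.

Lemma nonzero_fg_frac_of I :
  fg_ideal I -> I <> [set 0] -> nonzero_fg_fractional_ideal (frac_of I).
Proof.
move=> [n [a ->]] In0; split.
- have [I0 ID IM] := ideal_span_ideal a; split.
  + by exists 0; rewrite ?tofrac0.
  + by move=> _ _ [x Ix <-] [y Iy <-]; rewrite -tofracD; exists (x + y);
      [apply: ID|].
  + by move=> r _ [x Ix <-]; rewrite -tofracM; exists (r * x); [apply: IM|].
  + exists 1; first exact: oner_neq0.
    by move=> _ [x _ <-]; rewrite tofrac1 mul1r; apply: fracT.
- by move=> /frac_of_eq0.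
- exists n, (fun i => (a i)%:F); apply/seteqP; split.
    move=> _ [_ [c ->] <-]; exists c; rewrite rmorph_sum /=.
    by apply: eq_bigr => i _; rewrite tofracM.
  move=> _ [c ->]; exists (\sum_(i < n) c i * a i); first by exists c.
  by rewrite rmorph_sum /=; apply: eq_bigr => i _; rewrite tofracM.
Qed.

Lemma frac_invE E x :
  frac_inv E x <-> forall y, E y -> frac_of [set: D] (x * y).
Proof.
by split=> [Ex y Ey|Ex _ [y Ey <-]]; [apply: Ex; exists y | apply: Ex].
Qed.

Lemma sub_frac_inv2 E : E `<=` frac_inv (frac_inv E).
Proof.
by move=> x Ex; apply/frac_invE => y /frac_invE/(_ _ Ex); rewrite mulrC.
Qed.

Lemma v_closureE F : F <> [set 0] -> v_closure F = frac_inv (frac_inv F).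
Proof. by move=> F0; rewrite /v_closure; case: asboolP. Qed.

Lemma frac_mul_inv_sub F : frac_mul F (frac_inv F) `<=` frac_of [set: D].
Proof.
move=> _ [n [a [b [Fa Fb ->]]]].
elim/big_ind: _ => [|_ _ [r _ <-] [s _ <-]|i _].
- by rewrite -tofrac0; apply: fracT.
- by rewrite -tofracD; apply: fracT.
- by rewrite mulrC; move/frac_invE: (Fb i); apply.
Qed.

(** Multiplying F F^-1 by u^-1 shows that it contains 1, hence all of D. *)
Lemma invertible_of_unit F (u : D) :
  (forall (r : D) x, F x -> F (r%:F * x)) -> u \is a GRing.unit ->
  frac_mul F (frac_inv F) u%:F -> invertible F.
Proof.
move=> FM Uu [n [a [b [Fa Fb uE]]]]; apply/seteqP; split.
  exact: frac_mul_inv_sub.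
move=> _ [r _ <-]; exists n, (fun i => (r / u)%:F * a i), b; split => //.
  by move=> i; apply: FM.
rewrite -[in LHS](divrK Uu r) [LHS]tofracM uE mulr_sumr.
by apply: eq_bigr => i _; rewrite mulrA.
Qed.

Lemma invertible_generator F c :
  (forall (r : D) x, F x -> F (r%:F * x)) -> F c -> c != 0 ->
  (forall x, F x -> exists r : D, x = r%:F * c) -> invertible F.
Proof.
move=> FM Fc c0 genF.
apply: (@invertible_of_unit _ 1) => //; first exact: unitr1.
exists 1, (fun=> c), (fun=> c^-1); split=> // [_|].
  apply/frac_invE => x /genF [r ->]; rewrite mulrC mulfK //; exact: fracT.
by rewrite big_ord1 tofrac1 divff.
Qed.

End Ideals.

(** * The t-closure *)

Section TClosure.
Variable D : idomainType.
Local Notation K := {fraction D}.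
Implicit Types (I : set D) (E F : set K).

Lemma mem_t_closure F E :
  nonzero_fg_fractional_ideal F -> F `<=` E ->
  frac_inv (frac_inv F) `<=` t_closure E.
Proof.
move=> fgF FE x Fx; have [[F0 _ _ _] Fn0 _] := fgF; rewrite /t_closure.
case: asboolP => [E0|_]; last by exists F => //; rewrite v_closureE.
case: Fn0; apply/seteqP; split=> [y /FE|_ ->//]; by rewrite E0.
Qed.

Lemma t_closureP E x : E <> [set 0] -> t_closure E x ->
  exists F, [/\ nonzero_fg_fractional_ideal F, F `<=` E
              & frac_inv (frac_inv F) x].
Proof.
move=> En0; rewrite /t_closure; case: asboolP => // _ [F [fgF FE]].
by rewrite v_closureE => [|F0]; [exists F | case: fgF => _ /(_ F0)].
Qed.

Lemma sub_t_closure I :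
  is_ideal I -> frac_of I `<=` t_closure (frac_of I).
Proof.
move=> [I0 _ IM] _ [x Ix <-].
have [IE|In0] := pselect (frac_of I = [set 0]).
  by rewrite /t_closure; case: asboolP => // _; rewrite -IE; exists x.
(* The ideals allowed in the union defining the t-closure are nonzero, so for
   x = 0 the ideal zD has to come from some other element z. *)
have [z [Iz z0 zx]] : exists z, [/\ I z, z != 0 & principal_set z x].
  have [x0|x0] := eqVneq x 0; last first.
    by exists x; split=> //; exists 1; rewrite ?mul1r.
  apply: contrapT => nz; apply: In0; apply/seteqP.
  split=> [_ [z Iz <-]|_ ->]; last by exists 0; rewrite ?tofrac0.
  have [->|z0] := eqVneq z 0; first by rewrite tofrac0.
  by case: nz; exists z; split=> //; exists 0; rewrite ?mul0r.
apply: (@mem_t_closure (frac_of (principal_set z))).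
- apply: nonzero_fg_frac_of.
    by exists 1, (fun=> z); exact: principal_span.
  move=> zE; have : [set 0] z by rewrite -zE; exists 1; rewrite ?mul1r.
  by move=> /eqP; rewrite (negPf z0).
- by move=> _ [_ [r _ <-] <-]; exists (r * z) => //; apply: IM.
- by apply: sub_frac_inv2; exists x.
Qed.

Lemma t_closure_integral E :
  E `<=` frac_of [set: D] -> t_closure E `<=` frac_of [set: D].
Proof.
move=> ED x; have [->|En0] := pselect (E = [set 0]).
  rewrite /t_closure; case: asboolP => // _ ->; rewrite -tofrac0; exact: fracT.
move=> /(t_closureP En0) [F [_ FE /frac_invE/(_ 1)]]; rewrite mulr1; apply.
by apply/frac_invE => y /FE/ED; rewrite mul1r.
Qed.

Lemma t_closure_D : t_closure (frac_of [set: D]) = frac_of [set: D].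
Proof.
by apply/seteqP; split; [apply: t_closure_integral | apply: sub_t_closure].
Qed.

(** For x = 0 this fails by convention, since (0)^t = (0) whereas the t-closure
    of a set that contains no nonzero finitely generated ideal may be empty. *)
Lemma t_closure_mono E E' x :
  E `<=` E' -> x != 0 -> t_closure E x -> t_closure E' x.
Proof.
move=> EE' x0; have [->|En0] := pselect (E = [set 0]).
  by rewrite /t_closure; case: asboolP => // _ /eqP; rewrite (negPf x0).
move=> /(t_closureP En0) [F [fgF FE Fx]].
by apply: mem_t_closure Fx => // y /FE/EE'.
Qed.

End TClosure.

(** * Local and t-local domains *)

Section Local.
Variable D : idomainType.
Local Notation K := {fraction D}.
Local Notation nonunits := [set x : D | x \isn't a GRing.unit].

Lemma ideal_full (J : set D) (u : D) :
  is_ideal J -> u \is a GRing.unit -> J u -> J = [set: D].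
Proof.
move=> [_ _ JM] Uu Ju; apply/seteqP; split=> // x _.
by rewrite -(divrK Uu x); apply: JM.
Qed.

Lemma maximal_nonunits (M : set D) : maximal_ideal M -> M `<=` nonunits.
Proof. by move=> [idM MT _] x Mx; apply/negP => /(ideal_full idM)/(_ Mx). Qed.

(** Zorn's lemma asks that the empty chain have its union in the family, so the
    empty set is admitted next to the proper ideals containing x. *)
Lemma nonunit_maximal (x : D) : x \isn't a GRing.unit ->
  exists2 M : set D, maximal_ideal M & M x.
Proof.
move=> Ux; pose proper (J : set D) := [/\ is_ideal J, J x & ~ J 1].
have [|A [PA maxA]] := @Zorn_bigcup D [set J | J = set0 \/ proper J].
  move=> C CP Ctot.
  have [[J0 CJ0 [y J0y]]|C0] := pselect (exists2 J, C J & J !=set0); last first.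
    left; apply/seteqP; split=> // y [J CJ Jy].
    by apply: C0; exists J => //; exists y.
  have Cproper J z : C J -> J z -> proper J.
    by move=> CJ Jz; have [JE|//] := CP _ CJ; rewrite JE in Jz.
  right; have [[J00 _ _] J0x _] := Cproper _ _ CJ0 J0y; split; last 1 first.
  - by move=> [J CJ J1]; have [_ _] := Cproper _ _ CJ J1.
  - split; first by exists J0.
    + move=> u v [J CJ Ju] [L CL Lv].
      have [[_ JD _] _ _] := Cproper _ _ CJ Ju.
      have [[_ LD _] _ _] := Cproper _ _ CL Lv.
      have [JL|LJ] := Ctot _ _ CJ CL.
        by exists L => //; apply: LD => //; apply: JL.
      by exists J => //; apply: JD => //; apply: LJ.
    + move=> r u [J CJ Ju]; have [[_ _ JM] _ _] := Cproper _ _ CJ Ju.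
      by exists J => //; apply: JM.
  - by exists J0.
have [A0|[idA Ax A1]] := PA.
  exfalso; apply: (maxA (principal_set x)).
    rewrite A0; split; first exact: sub0set.
    by move/(_ x); apply; exists 1; rewrite ?mul1r.
  right; split; first exact: principal_set_ideal.
  - by exists 1; rewrite ?mul1r.
  - move=> [r _ rx]; case/negP: Ux.
    by apply/unitrP; exists r; rewrite [x * _]mulrC rx.
exists A => //; split => // [AT|J idJ AJ]; first by apply: A1; rewrite AT.
have [J1|J1] := pselect (J 1); first by right; apply: ideal_full (unitr1 D) J1.
left; have [JA|JA] := pselect (J `<=` A); first exact/seteqP.
by case: (maxA J) => //; right; split=> //; apply: AJ.
Qed.

Lemma local_maximal (M : set D) :
  local_domain D -> maximal_ideal M -> M = nonunits.
Proof.
move=> [N [_ uniqN]] maxM; apply/seteqP; split.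
  exact: maximal_nonunits.
by move=> x /nonunit_maximal [L /uniqN <-]; rewrite (uniqN _ maxM).
Qed.

Lemma local_unit_sum n (f : 'I_n -> D) : local_domain D ->
  \sum_(i < n) f i \is a GRing.unit -> exists i, f i \is a GRing.unit.
Proof.
move=> locD; have [M [maxM _]] := locD; have ME := local_maximal locD maxM.
have [idM _ _] := maxM; apply: contraPP => /forallNP nUf.
by apply/negP; have : M (\sum_(i < n) f i);
  [apply: ideal_sum => // i; rewrite ME; exact/negP | rewrite ME].
Qed.

Lemma local_nonunits :
  (forall x y : D, nonunits x -> nonunits y -> nonunits (x + y)) ->
  local_domain D.
Proof.
move=> nUD.
have idN : is_ideal nonunits.
  split=> //=; first by rewrite unitr0.
  by move=> r x; rewrite unitrM negb_and => ->; rewrite orbT.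
have NT : nonunits <> [set: D].
  by move=> NT; have : nonunits 1; [rewrite NT | rewrite /= unitr1].
have maxN : maximal_ideal nonunits.
  split=> // J idJ NJ; have [JN|] := pselect (J `<=` nonunits).
    by left; apply/seteqP.
  move=> /existsNP [u /not_implyP [Ju /negP]]; rewrite negbK => Uu.
  by right; apply: ideal_full Uu Ju.
exists nonunits; split=> // M maxM.
have [idM MT /(_ _ idN (maximal_nonunits maxM))] := maxM.
by case=> // NTE; case: NT.
Qed.

(** A set E without units lies in the maximal ideal M, so that its t-closure
    lies in M^t = M. *)
Lemma t_local_one (E : set K) : t_local D -> E `<=` frac_of [set: D] ->
  t_closure E 1 -> exists2 u : D, u \is a GRing.unit & E u%:F.
Proof.
move=> [locD tD] ED E1; apply/not_exists2P => nU.
have [M [maxM _]] := locD; have ME := local_maximal locD maxM.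
have EM : E `<=` frac_of M.
  move=> x Ex; have [r _ rx] := ED _ Ex; exists r => //; rewrite ME.
  by apply/negP => Ur; have [] := nU r; rewrite ?rx.
have : frac_of M 1.
  by rewrite (tD _ maxM); apply: t_closure_mono EM _ E1; apply: oner_neq0.
by rewrite -tofrac1 => /frac_ofE; rewrite ME /= unitr1.
Qed.

End Local.

(** * Valuation domains *)

Section Valuation.
Variable D : idomainType.
Local Notation K := {fraction D}.
Hypothesis valD : valuation_domain D.

(** The divisor c is 0 or one of the a_i, chosen by comparing them in turn; an
    arbitrary ideal J containing the a_i records that c is in their span, and
    does not change along the induction on n. *)
Lemma valuation_common_divisor (J : set D) n (a : 'I_n -> D) :
  is_ideal J -> (forall i, J (a i)) ->
  exists2 c, J c & forall i, principal_set c (a i).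
Proof.
move=> idJ; have [J0 _ _] := idJ; elim: n a => [|n IHn] a Ja.
  by exists 0 => // -[].
have [|c Jc ca] := IHn (fun i => a (lift ord0 i)); first by move=> i; apply: Ja.
have [[r _ rc]|[r _ rc]] := proj1 (valuation_domainP D) valD c (a ord0).
  exists c => // i; have [j ->|->] := unliftP ord0 i; first exact: ca.
  by exists r.
exists (a ord0) => // i; have [j ->|->] := unliftP ord0 i.
  by have [s _ <-] := ca j; exists (s * r); rewrite // -mulrA rc.
by exists 1; rewrite ?mul1r.
Qed.

Lemma valuation_Bezout : Bezout_domain D.
Proof.
move=> _ [n [a ->]] _.
have idI := ideal_span_ideal a.
have [c Ic ca] := valuation_common_divisor idI (ideal_span_gen a).
exists c; apply/seteqP; split.
  by apply: ideal_span_sub => //; exact: principal_set_ideal.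
by move=> _ [r _ <-]; case: idI => _ _; apply.
Qed.

Lemma valuation_GCD : GCD_domain D.
Proof.
have dvdI (a b : D) : principal_set a b ->
    principal_set a `&` principal_set b = principal_set b.
  move=> [r _ <-]; apply/seteqP; split=> [x []//|x [s _ <-]].
  by split; [exists (s * r); rewrite // mulrA | exists s].
move=> a b; have [ab|ba] := proj1 (valuation_domainP D) valD a b.
  by exists b; apply: dvdI.
by exists a; rewrite setIC; apply: dvdI.
Qed.

End Valuation.

(** * Bezout, Pruefer and GCD domains *)

Section Implications.
Variable D : idomainType.
Local Notation K := {fraction D}.

(** Some d != 0 carries F into D; the generator of the principal ideal dF of D,
    divided by d, generates F. *)
Lemma Bezout_generator (F : set K) :
  Bezout_domain D -> nonzero_fg_fractional_ideal F ->
  exists c, [/\ F c, c != 0 & forall x, F x -> exists r : D, x = r%:F * c].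
Proof.
move=> bezD [[F0 _ _ [d d0 dF]] Fn0 [n [a FE]]].
have dK : d%:F != 0 :> K by rewrite tofrac_eq0.
have Fa i : F (a i).
  rewrite FE; exists (fun j => (j == i)%:R).
  rewrite (bigD1 i) //= eqxx tofrac1 mul1r big1 ?addr0 //.
  by move=> j /negPf ->; rewrite tofrac0 mul0r.
have /choice [b bE] i : exists r : D, r%:F = d%:F * a i.
  by have [r _ <-] := dF _ (Fa i); exists r.
have FbE (c : 'I_n -> D) :
    d%:F * \sum_(i < n) (c i)%:F * a i = (\sum_(i < n) c i * b i)%:F.
  rewrite mulr_sumr rmorph_sum /=; apply: eq_bigr => i _.
  by rewrite tofracM bE mulrCA.
have [g gE] : principal_ideal (ideal_span b).
  apply: bezD; first by exists n, b.
  move=> b0; apply: Fn0; apply/seteqP; split=> [x|_ ->//].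
  rewrite FE => -[c ->].
  have : [set 0] (\sum_(i < n) c i * b i) by rewrite -b0; exists c.
  move=> /= c0; apply/eqP; rewrite -(inj_eq (mulfI dK)) mulr0 FbE c0.
  by rewrite tofrac0.
have genF x : F x -> exists r : D, x = r%:F * (g%:F / d%:F).
  rewrite FE => -[c ->].
  have : principal_set g (\sum_(i < n) c i * b i) by rewrite -gE; exists c.
  move=> [r _ rg]; exists r.
  apply: (mulfI dK); rewrite FbE -rg tofracM.
  by rewrite [RHS]mulrCA [d%:F * _]mulrC divfK.
have Fc : F (g%:F / d%:F).
  have : ideal_span b g by rewrite gE; exists 1; rewrite ?mul1r.
  move=> [c gc]; rewrite FE; exists c; apply: (mulfI dK).
  by rewrite FbE -gc mulrC divfK.
exists (g%:F / d%:F); split=> //.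
apply: contra_notN Fn0 => /eqP c0; apply/seteqP.
split=> [x /genF [r ->]|_ ->//].
by rewrite c0 mulr0.
Qed.

Lemma Bezout_PvMD : Bezout_domain D -> PvMD D.
Proof.
move=> bezD F fgF; have [c [Fc c0 genF]] := Bezout_generator bezD fgF.
have [[_ _ FM _] _ _] := fgF.
by rewrite (invertible_generator FM Fc c0 genF) t_closure_D.
Qed.

(** For a nonzero finitely generated ideal I inside M, I = cD is its own
    v-closure: multiplying an element x of the v-closure by 1/c, which lies in
    the inverse of I, gives an element of D. *)
Lemma valuation_t_local : valuation_domain D -> t_local D.
Proof.
move=> valD.
have locD : local_domain D.
  apply: local_nonunits.
  have nUD (x r : D) : x \isn't a GRing.unit -> x + r * x \isn't a GRing.unit.
    by rewrite -[X in X + _]mul1r -mulrDl unitrM negb_and => ->; rewrite orbT.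
  move=> x y /= Ux Uy.
  have [[r _ <-]|[r _ <-]] := proj1 (valuation_domainP D) valD x y.
    exact: nUD.
  by rewrite addrC; apply: nUD.
split=> // M maxM; have [idM _ _] := maxM; have [_ _ MM] := idM.
apply/seteqP; split; first exact: sub_t_closure.
have [ME x|Mn0 x /(t_closureP Mn0)] := pselect (frac_of M = [set 0]).
  by rewrite /t_closure; case: asboolP => // _; rewrite ME.
move=> [F [fgF FM Fx]].
have [c [Fc c0 genF]] := Bezout_generator (valuation_Bezout valD) fgF.
have [m Mm mc] := FM _ Fc.
have [r _ rE] : frac_of [set: D] (x * c^-1).
  move/frac_invE: Fx; apply; apply/frac_invE => y /genF [r ->].
  by rewrite mulrC mulfK //; apply: fracT.
exists (r * m); first exact: MM.
by rewrite tofracM rE mc divfK.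
Qed.

(** With aD and bD meeting in mD and m = au = bw, the ratio of a to b is that
    of w to u, so it suffices that u or w is a unit; and (u, w)^v = D because
    (u, w)^-1 = D. *)
Lemma GCD_valuation : t_local D -> GCD_domain D -> valuation_domain D.
Proof.
move=> tD gcdD; apply/valuation_domainP => a b.
have [->|a0] := eqVneq a 0; first by right; exists 0; rewrite ?mul0r.
have [->|b0] := eqVneq b 0; first by left; exists 0; rewrite ?mul0r.
have [m mE] := gcdD a b.
have [[u _ um] [w _ wm]] : principal_set a m /\ principal_set b m.
  by apply: (_ : (principal_set a `&` principal_set b) m); rewrite mE; exists 1;
    rewrite ?mul1r.
have m0 : m != 0.
  have : principal_set m (a * b).
    by rewrite -mE; split; [exists b; rewrite // mulrC | exists a].
  by move=> [r _ rm]; apply: contra_neq (mulf_neq0 a0 b0) => m0; rewrite -rm m0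
    mulr0.
have u0 : u != 0 by apply: contra_neq m0 => u0; rewrite -um u0 mul0r.
pose uw (i : 'I_2) := if i == ord0 then u else w.
have uI : ideal_span uw u by apply: (ideal_span_gen uw ord0).
have wI : ideal_span uw w by apply: (ideal_span_gen uw ord_max).
have [||v Uv] := @t_local_one D (frac_of (ideal_span uw)) tD; last 1 first.
- move=> /frac_ofE [c cE].
  move: Uv; rewrite cE => /(local_unit_sum (proj1 tD)) [i].
  rewrite unitrM => /andP [_]; rewrite /uw; case: ifP => _ Ui.
    by right; exists (w / u) => //; apply: (mulrI Ui);
      rewrite mulrA [u * _]mulrC divrK // wm um.
  by left; exists (u / w) => //; apply: (mulrI Ui);
    rewrite mulrA [w * _]mulrC divrK // wm um.
- by move=> _ [x _ <-]; apply: fracT.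
apply: (@mem_t_closure D (frac_of (ideal_span uw))) => //.
  apply: nonzero_fg_frac_of; first by exists 2, uw.
  by move=> I0; move: uI; rewrite I0 => /eqP; rewrite (negPf u0).
apply/frac_invE => x /frac_invE xI; rewrite mul1r.
(* From here on, x in (u, w)^-1 is shown to lie in D: xm is a common multiple
   of a and b, hence a multiple of m. *)
have [p _ pE] : frac_of [set: D] (x * u%:F) by apply: xI; exists u.
have [q _ qE] : frac_of [set: D] (x * w%:F) by apply: xI; exists w.
have mF : m%:F != 0 :> K by rewrite tofrac_eq0.
have paE : (p * a)%:F = x * m%:F by rewrite tofracM pE -um tofracM mulrA.
have qbE : (q * b)%:F = x * m%:F by rewrite tofracM qE -wm tofracM mulrA.
have : principal_set m (p * a).
  rewrite -mE; split; first by exists p.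
  by exists q => //; apply: tofrac_inj; rewrite paE.
move=> [r _ rm]; exists r => //; apply: (mulIf mF).
by rewrite -paE -rm tofracM.
Qed.

Lemma PvMD_Prufer : t_local D -> PvMD D -> Prufer_domain D.
Proof.
move=> tD pvD I fgI In0; have fgF := nonzero_fg_frac_of fgI In0.
have [[_ _ FM _] _ _] := fgF.
have [|u Uu Fu] := t_local_one tD (@frac_mul_inv_sub _ (frac_of I)).
  by rewrite pvD // -tofrac1; apply: fracT.
exact: invertible_of_unit Uu Fu.
Qed.

(** Invertibility of (a, b) gives p in K^2 with sum of the ab_j p_j equal to 1
    and all products ab_k p_j in D; where ab_j p_j is a unit, ab_j divides both
    generators. *)
Lemma Prufer_valuation :
  local_domain D -> Prufer_domain D -> valuation_domain D.
Proof.
move=> locD pruD; apply/valuation_domainP => a b.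
have [->|a0] := eqVneq a 0; first by right; exists 0; rewrite ?mul0r.
pose ab (i : 'I_2) := if i == ord0 then a else b.
have aI : ideal_span ab a by apply: (ideal_span_gen ab ord0).
pose I := frac_of (ideal_span ab).
have : frac_mul I (frac_inv I) 1.
  rewrite (pruD (ideal_span ab)); first by rewrite -tofrac1; apply: fracT.
    by exists 2, ab.
  by move=> I0; move: aI; rewrite I0 => /eqP; rewrite (negPf a0).
move=> [n [f [g [If Ig fgE]]]].
have abD k i : frac_of [set: D] ((ab k)%:F * g i).
  rewrite mulrC; move/frac_invE: (Ig i); apply.
  by exists (ab k) => //; apply: ideal_span_gen.
have /choice [c cE] i : exists c : 'I_2 -> D,
    f i = (\sum_(j < 2) c j * ab j)%:F.
  by have [_ [c ->] <-] := If i; exists c.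
(* The entry p_j collects the coefficients of the generator ab_j when every
   f_i is expanded in the sum of the f_i g_i, which is 1. *)
pose p (j : 'I_2) := \sum_(i < n) (c i j)%:F * g i.
have abp k j : frac_of [set: D] ((ab k)%:F * p j).
  rewrite mulr_sumr; elim/big_ind: _ => [|_ _ [r _ <-] [s _ <-]|i _].
  - by rewrite -tofrac0; apply: fracT.
  - by rewrite -tofracD; apply: fracT.
  - by have [r _ rE] := abD k i; rewrite mulrCA -rE -tofracM; apply: fracT.
have /choice [t tE] j : exists r : D, r%:F = (ab j)%:F * p j.
  by have [r _ <-] := abp j j; exists r.
have t1 : \sum_(j < 2) t j = 1.
  apply: tofrac_inj; rewrite tofrac1 fgE rmorph_sum /=.
  under eq_bigr do rewrite tE mulr_sumr.
  rewrite exchange_big; apply: eq_bigr => i _.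
  rewrite cE rmorph_sum /= mulr_suml; apply: eq_bigr => j _.
  by rewrite tofracM mulrCA mulrA.
have [|j Utj] := local_unit_sum (f := t) locD; first by rewrite t1 unitr1.
have dvd_ab k : principal_set (ab j) (ab k).
  have [s _ sE] := abp k j; exists (s / t j) => //; apply: (mulrI Utj).
  rewrite mulrA [t j * _]mulrC divrK //; apply: tofrac_inj.
  by rewrite !tofracM sE tE mulrAC [_ * (ab k)%:F]mulrC mulrA.
by move: dvd_ab; rewrite {1}/ab; case: ifP => _ dvd_ab;
  [left; apply: (dvd_ab ord_max) | right; apply: (dvd_ab ord0)].
Qed.

End Implications.

Theorem proposition5p2 (D : idomainType) :
  [<-> valuation_domain D;
       t_local D /\ GCD_domain D;
       t_local D /\ Bezout_domain D;
       t_local D /\ PvMD D;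
       t_local D /\ Prufer_domain D].
Proof.
tfae.
- by move=> valD; split; [apply: valuation_t_local | apply: valuation_GCD].
- by move=> [tD gcdD]; split=> //; apply/valuation_Bezout/GCD_valuation.
- by move=> [tD bezD]; split=> //; apply: Bezout_PvMD.
- by move=> [tD pvD]; split=> //; apply: PvMD_Prufer.
- by move=> [[locD _] pruD]; apply: Prufer_valuation.
Qed.
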